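(* Let $\alpha_1,\alpha_2,\bar S>0$ and let $\sigma_k=\sigma$ for all $k$, where $\sigma>0$ is a constant. Let $\mathcal{U}\subseteq\mathbb{R}^{Nm+1}$ be the domain of the extended decision vector $\bm{U}=(\bm{u}^\top,T)^\top$, on which the following are assumed to hold: (A1) $\frac{\partial \bm{G}}{\partial \bm{u}}(\bm{U})\in\mathbb{R}^{n\times Nm}$ has full row rank for all $\bm{U}\in\mathcal{U}$. (A2) $\left\|\left(\frac{\partial \bm{G}}{\partial \bm{u}}(\bm{U})\right)^{+}\right\|_1\le \alpha_1$ for all $\bm{U}\in\mathcal{U}$. (A3) There exists $\lambda>0$ such that for all $\bm{U}'=(\bm{u}'^\top,T')^\top$ and $\bm{U}''=(\bm{u}''^\top,T'')^\top$ in $\mathcal{U}$ with $|T'-T''|\le\bar S$, one has $\|\mathcal{J}_{\bm{G}}(\bm{U}')-\mathcal{J}_{\bm{G}}(\bm{U}'')\|_1\le\lambda\|\bm{U}'-\bm{U}''\|_1$. (A4) With this $\lambda$, $\ \lambda(\alpha_1+\alpha_2)^2\|\bm{G}(\bm{U}_0)\|_1/2<1$. (A5) With this $\lambda$, $\ \sigma<2/[\lambda(\alpha_1+\alpha_2)^2]$. Let $(\bm{U}_k)_{k\ge0}$ be generated from the initial guess $\bm{U}_0$ by the free-horizon Newton update (defined in the context) with $\sigma_k=\sigma$. Then there exists an update step (integer) $\bar k>0$ such that $\|\bm{G}(\bm{U}_k)\|_1\le\sigma$ for all $k\ge\bar k$.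
   Context: Setting. Fix positive integers $n,m,N$, an initial state $\bm{x}_0\in\mathbb{R}^n$ and a target state $\bm{x}_{\mathrm f}\in\mathbb{R}^n$. The discrete-time dynamics (obtained from a continuous-time control system by a discretization scheme such as fourth-order Runge--Kutta with zero-order hold on the input) are $$\bm{x}[j+1]=\bm{f}(\bm{x}[j],\widetilde{\bm{u}}[j];\tau),\quad j=0,\dots,N-1,\qquad \bm{x}[0]=\bm{x}_0,\qquad \tau=T/N,$$ with states $\bm{x}[j]\in\mathbb{R}^n$, inputs $\widetilde{\bm{u}}[j]\in\mathbb{R}^m$, and control horizon $T$, which is a free variable. Write $\bm{u}=[\widetilde{\bm{u}}[0]^\top,\dots,\widetilde{\bm{u}}[N-1]^\top]^\top\in\mathbb{R}^{Nm}$ and define the extended decision vector $\bm{U}=(\bm{u}^\top,T)^\top\in\mathbb{R}^{Nm+1}$. The terminal state $\bm{x}[N]$ is a function of $\bm{U}$, and $$\bm{G}(\bm{U})=\bm{x}[N](\bm{U})-\bm{x}_{\mathrm f}\in\mathbb{R}^n,\qquad \mathcal{J}_{\bm{G}}(\bm{U})=\left(\frac{\partial\bm{G}}{\partial\bm{u}}(\bm{U}),\frac{\partial\bm{G}}{\partial T}(\bm{U})\right)\in\mathbb{R}^{n\times(Nm+1)}.$$ $\bm{G}$ is assumed continuously differentiable on an open set containing $\mathcal{U}$. All extended decision vectors under consideration lie in the domain $\mathcal{U}$; in particular the iterates $\bm{U}_k$ and the segments joining $\bm{U}_k$ to $\bm{U}_{k+1}$ lie in $\mathcal{U}$. Norms.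 $\|\cdot\|_1$ is the $\ell^1$-norm on vectors and the induced operator norm on matrices; $A^{+}$ is the Moore--Penrose pseudoinverse of $A$. Free-horizon Newton update. Given parameters $\alpha_1,\alpha_2,\bar S>0$, $\sigma_k\ge0$ and $\bm{U}_0=(\bm{u}_0^\top,T_0)^\top$, set $\bm{U}_{k+1}=\bm{U}_k-\bm{W}_k$, where $\bm{U}_k=(\bm{u}_k^\top,T_k)^\top$ and $\bm{W}_k=(\bm{w}_k^\top,S_k)^\top\in\mathbb{R}^{Nm+1}$ (with $\bm{w}_k\in\mathbb{R}^{Nm}$, $S_k\in\mathbb{R}$) is a solution of $$\underset{\bm{w}_k,S_k}{\text{minimize}}\ \ T_k\|\bm{u}_k-\bm{w}_k\|_1-S_k\|\bm{u}_k\|_1$$ subject to $$\mathcal{J}_{\bm{G}}(\bm{U}_k)\bm{W}_k=\bm{G}(\bm{U}_k),$$ $$\|\bm{w}_k\|_1\le\alpha_1\max(\|\bm{G}(\bm{U}_k)\|_1,\sigma_k),$$ $$|S_k|\le\min\bigl(\bar S,\ \alpha_2\max(\|\bm{G}(\bm{U}_k)\|_1,\sigma_k)\bigr).$$ *)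

(* Defs.v *)
From HB Require Import structures.
From mathcomp Require Import all_boot all_order all_algebra.
From mathcomp Require Import all_classical all_reals all_analysis.

Set Implicit Arguments.
Unset Strict Implicit.
Unset Printing Implicit Defensive.

Import Order.TTheory GRing.Theory Num.Theory.
Import numFieldNormedType.Exports.

Local Open Scope classical_set_scope.
Local Open Scope ring_scope.

Section L1Norm.
Variable R : realType.

Definition l1norm p (v : 'cV[R]_p) : R := \sum_i `|v i 0|.

Definition l1opnorm p q (A : 'M[R]_(p, q)) : R :=
  sup [set l1norm (A *m v) | v in [set v : 'cV[R]_q | l1norm v <= 1]].

End L1Norm.

Section MoorePenrose.
Variable R : realType.

(* The four Penrose equations (over the reals, the adjoint is the transpose). *)
Definition penrose p q (A : 'M[R]_(p, q)) (B : 'M[R]_(q, p)) : Prop :=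
  [/\ A *m B *m A = A, B *m A *m B = B,
      (A *m B)^T = A *m B & (B *m A)^T = B *m A].

(* MathComp's [pinvmx] is only a partial inverse, not the Moore-Penrose one.
   The default value 0 is never used: see [pinv_mpP]. *)
Definition pinv_mp p q (A : 'M[R]_(p, q)) : 'M[R]_(q, p) :=
  xget 0 [set B | penrose A B].

Lemma penrose_uniq p q (A : 'M[R]_(p, q)) (B C : 'M[R]_(q, p)) :
  penrose A B -> penrose A C -> B = C.
Proof.
move=> [AB1 AB2 AB3 AB4] [AC1 AC2 AC3 AC4].
have E1 : A *m B = A *m C.
  rewrite -AB3 -{1}AC1 -(mulmxA _ A B) trmx_mul AB3 AC3.
  by rewrite mulmxA AB1.
have E2 : B *m A = C *m A.
  rewrite -AB4 -{1}AC1 -mulmxA (mulmxA B) trmx_mul AB4 AC4.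
  by rewrite -mulmxA (mulmxA A) AB1.
by rewrite -AB2 -mulmxA E1 mulmxA E2 AC2.
Qed.

Lemma gram_unitmx p q (A : 'M[R]_(p, q)) : row_free A -> A *m A^T \in unitmx.
Proof.
move=> fA; rewrite -row_free_unit -kermx_eq0; apply/eqP/row_matrixP => i.
rewrite row0; set v := row i _.
have vAA : v *m (A *m A^T) = 0 by rewrite -row_mul mulmx_ker row0.
suff vA : v *m A = 0 by apply/eqP; rewrite -(mulmx_free_eq0 _ fA) vA.
have : (v *m A) *m (v *m A)^T = 0.
  by rewrite trmx_mul mulmxA -(mulmxA v) vAA mul0mx.
move/matrixP/(_ 0 0); rewrite !mxE => s0.
apply/rowP => j; rewrite [RHS]mxE; apply/eqP; rewrite -sqrf_eq0 expr2.
have /psumr_eq0P : forall k : 'I_q, true -> 0 <= (v *m A) 0 k * (v *m A)^T k 0.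
  by move=> k _; rewrite (mxE _ _ k) -expr2 sqr_ge0.
by move=> /(_ s0 j isT); rewrite [X in _ * X]mxE => ->.
Qed.

Lemma penrose_mul p r q (C : 'M[R]_(p, r)) (D : 'M[R]_(r, q)) :
  C^T *m C \in unitmx -> D *m D^T \in unitmx ->
  penrose (C *m D)
    (D^T *m invmx (D *m D^T) *m (invmx (C^T *m C) *m C^T)).
Proof.
move=> uC uD; set P := invmx (D *m D^T); set Q := invmx (C^T *m C).
have PT : P^T = P by rewrite trmx_inv trmx_mul trmxK.
have QT : Q^T = Q by rewrite trmx_inv trmx_mul trmxK.
set B := D^T *m P *m (Q *m C^T).
have AB : C *m D *m B = C *m (Q *m C^T).
  by rewrite /B -!mulmxA (mulmxA D) (mulmxA (D *m D^T)) mulmxV // mul1mx.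
have BA : B *m (C *m D) = D^T *m P *m D.
  by rewrite /B -!mulmxA (mulmxA C^T) (mulmxA Q) mulVmx // mul1mx.
split.
- by rewrite AB -!mulmxA (mulmxA C^T) (mulmxA Q) mulVmx // mul1mx.
- rewrite BA /B -!mulmxA (mulmxA D) (mulmxA (D *m D^T)) mulmxV //.
  by rewrite mul1mx.
- by rewrite AB !trmx_mul trmxK QT mulmxA.
- by rewrite BA !trmx_mul trmxK PT mulmxA.
Qed.

Lemma penrose_exists p q (A : 'M[R]_(p, q)) : exists B, penrose A B.
Proof.
rewrite -(mulmx_base A); eexists; apply: penrose_mul; last first.
  by apply/gram_unitmx/row_base_free.
rewrite -{2}(trmxK (col_base A)); apply: gram_unitmx.
by rewrite /row_free mxrank_tr -/(row_full _) col_base_full.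
Qed.

Lemma pinv_mpP p q (A : 'M[R]_(p, q)) : penrose A (pinv_mp A).
Proof. by apply: xgetPex; exact: penrose_exists. Qed.

End MoorePenrose.

Section Differential.
Variable R : realType.

(* Entry (i, j) is the partial derivative of the i-th component of [g] along
   the j-th coordinate. The library's [jacobian] acts on row vectors and is the
   transpose of this matrix. *)
Definition jac p q (g : 'cV[R]_p -> 'cV[R]_q) (x : 'cV[R]_p) : 'M[R]_(q, p) :=
  \matrix_(i, j) 'D_(delta_mx j 0) (fun y => g y i 0) x.

Definition C1_near p q (g : 'cV[R]_p -> 'cV[R]_q) (D : set 'cV[R]_p) : Prop :=
  exists O : set 'cV[R]_p,
    [/\ open O, D `<=` O, forall x, O x -> differentiable g x
      & forall x, O x -> {for x, continuous (jac g)}].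

End Differential.

Section FreeHorizon.
Variables (R : realType) (n m N : nat).

(* Extended decision vectors U = (u^T, T)^T. *)
Local Notation decision := 'cV[R]_(N * m + 1).

Definition inputs (U : decision) : 'cV[R]_(N * m) := usubmx U.

Definition horizon (U : decision) : R := dsubmx U 0 0.

(* The j-th length-m block of the stacked inputs; 0 when j >= N, which the
   definition of [terminal_error] never reaches. *)
Definition input (U : decision) (j : nat) : 'cV[R]_m :=
  if insub j is Some j' then \col_(i < m) inputs U (mxvec_index (j' : 'I_N) i) 0
  else 0.

Variable f : 'cV[R]_n -> 'cV[R]_m -> R -> 'cV[R]_n.
Variables x0 xf : 'cV[R]_n.

Fixpoint state (U : decision) (j : nat) : 'cV[R]_n :=
  if j is j'.+1 then f (state U j') (input U j') (horizon U / N%:R) else x0.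

Definition terminal_error (U : decision) : 'cV[R]_n := state U N - xf.

End FreeHorizon.

Section NewtonUpdate.
Variables (R : realType) (n m N : nat).
Local Notation decision := 'cV[R]_(N * m + 1).
Variable G : decision -> 'cV[R]_n.

(* The block dG/du of the Jacobian (dG/du, dG/dT). *)
Definition jac_u (U : decision) : 'M[R]_(n, N * m) := lsubmx (jac G U).

Variables alpha1 alpha2 Sbar : R.

Definition feasible (s : R) (U W : decision) : Prop :=
  [/\ jac G U *m W = G U,
      l1norm (inputs W) <= alpha1 * Num.max (l1norm (G U)) s
    & `|horizon W| <= Num.min Sbar (alpha2 * Num.max (l1norm (G U)) s)].

Definition cost (U W : decision) : R :=
  horizon U * l1norm (inputs U - inputs W) - horizon W * l1norm (inputs U).

Definition newton_correction (s : R) (U W : decision) : Prop :=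
  feasible s U W /\ forall W', feasible s U W' -> cost U W <= cost U W'.

Definition newton_iterates (sigma : nat -> R) (U : nat -> decision) : Prop :=
  forall k, exists W, newton_correction (sigma k) (U k) W /\ U k.+1 = U k - W.

End NewtonUpdate.

(* Main.v *)
Require Import Defs.
From HB Require Import structures.
From mathcomp Require Import all_boot all_order all_algebra.
From mathcomp Require Import all_classical all_reals all_analysis.
From mathcomp Require Import ring lra.

Import Order.TTheory GRing.Theory Num.Theory.
Import numFieldNormedType.Exports.

Local Open Scope classical_set_scope.
Local Open Scope ring_scope.

Set Implicit Arguments.
Unset Strict Implicit.

(** Write g_k for the l1 norm of the terminal error at the k-th iterate, M_k
for the maximum of g_k and sigma, and c for lambda (alpha1 + alpha2)^2 / 2.

A Newton correction W solves the linearized equation exactly, so after the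
step the terminal error is the first-order remainder of G along the segment
from U_k to U_k - W. The trust-region bounds on the two blocks of W give
||W||_1 <= (alpha1 + alpha2) M_k, and the bound on the horizon block alone
keeps the segment within the reach of the Lipschitz condition on the Jacobian.
The remainder is then at most lambda ||W||_1^2 / 2
([l1norm_first_order_remainder]), whence g_{k+1} <= c M_k^2
([l1norm_newton_step]).

Since c g_0 < 1 and c sigma < 1, the ratio q = c M_0 is less than 1, and
the recurrence makes the error shrink at least geometrically with ratio q while
it exceeds sigma, and keeps it below sigma afterwards
([quadratic_recurrence_eventually_le]). *)

Lemma l1norm_ge0 (R : realType) p (v : 'cV[R]_p) : 0 <= l1norm v.
Proof. by apply: sumr_ge0. Qed.

Lemma l1normN (R : realType) p (v : 'cV[R]_p) : l1norm (- v) = l1norm v.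
Proof. by apply: eq_bigr => i _; rewrite mxE normrN. Qed.

Lemma l1normZ (R : realType) p (a : R) (v : 'cV[R]_p) :
  l1norm (a *: v) = `|a| * l1norm v.
Proof.
by rewrite /l1norm mulr_sumr; apply: eq_bigr => i _; rewrite mxE normrM.
Qed.

Lemma l1norm_eq0 (R : realType) p (v : 'cV[R]_p) : l1norm v = 0 -> v = 0.
Proof.
move=> v0; apply/colP => i; rewrite mxE; apply/normr0_eq0.
by have /psumr_eq0P/(_ v0) -> : forall i, true -> 0 <= `|v i 0|.
Qed.

(** This crude bound shows that the supremum in [l1opnorm] is taken over a
bounded set: [sup] of an unbounded set would be the junk value 0. *)
Lemma l1norm_mulmx_entries (R : realType) p q (A : 'M[R]_(p, q)) v :
  l1norm (A *m v) <= (\sum_i \sum_j `|A i j|) * l1norm v.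
Proof.
rewrite /l1norm mulr_suml; apply: ler_sum => i _; rewrite mxE.
apply: le_trans (ler_norm_sum _ _ _) _; rewrite mulr_suml.
apply: ler_sum => j _; rewrite normrM ler_wpM2l //.
by rewrite (bigD1 j) //= lerDl sumr_ge0.
Qed.

Lemma l1norm_mulmx_le (R : realType) p q (A : 'M[R]_(p, q)) v :
  l1norm (A *m v) <= l1opnorm A * l1norm v.
Proof.
have [v0|vn0] := eqVneq (l1norm v) 0.
  rewrite v0 mulr0 (l1norm_eq0 v0) mulmx0 /l1norm big1 // => i _.
  by rewrite mxE normr0.
have vgt0 : 0 < l1norm v by rewrite lt_def vn0 l1norm_ge0.
rewrite -ler_pdivrMr // mulrC.
have -> : (l1norm v)^-1 * l1norm (A *m v) = l1norm (A *m ((l1norm v)^-1 *: v)).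
  by rewrite -scalemxAr l1normZ ger0_norm // invr_ge0 ltW.
apply: ub_le_sup; last first.
  exists ((l1norm v)^-1 *: v) => //=.
  by rewrite l1normZ ger0_norm ?invr_ge0 ?(ltW vgt0) // mulVf.
exists (\sum_i \sum_j `|A i j|) => _ [w /= w1 <-].
apply: le_trans (l1norm_mulmx_entries _ _) _.
by apply: ler_piMr => //; do 2!apply: sumr_ge0 => ? _.
Qed.

(** The difference quotients of the restriction of [h] to the line and those of
[h] in the direction [v] are the same function of the increment, so both
derivatives are limits of one and the same expression. *)
Lemma is_derive_along_line (R : realType) (V : normedModType R) (h : V -> R)
    (x v : V) (t : R) :
  differentiable h (x + t *: v) ->
  is_derive t 1 (fun s : R => h (x + s *: v)) ('D_v h (x + t *: v)).
Proof.
move=> dh.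
have E : (fun r : R =>
      r^-1 *: (((fun s : R => h (x + s *: v)) \o shift t) (r *: 1)
               - h (x + t *: v)))
  = (fun r : R =>
      r^-1 *: ((h \o shift (x + t *: v)) (r *: v) - h (x + t *: v))).
  apply/funext => r /=; congr (_ *: (h _ - _)).
  by rewrite scalerDl /GRing.scale /= mulr1 addrCA.
apply: DeriveDef; first by rewrite /derivable E; exact: diff_derivable.
by rewrite /derive E.
Qed.

Lemma differentiable_entry (R : realType) p q (g : 'cV[R]_p -> 'cV[R]_q) x i :
  differentiable g x -> differentiable (fun y => g y i 0) x.
Proof.
move=> dg.
apply: (@differentiable_comp _ _ _ _ g (fun M : 'cV[R]_q => M i 0)) => //.
exact: differentiable_coord.
Qed.

(** The entries of [jac] are only directional derivatives; differentiability is
what makes the directional derivative linear in the direction. *)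
Lemma jac_mulmxE (R : realType) p q (g : 'cV[R]_p -> 'cV[R]_q) x v i :
  differentiable g x -> (jac g x *m v) i 0 = 'D_v (fun y => g y i 0) x.
Proof.
move=> /(@differentiable_entry _ _ _ _ _ i) dg.
rewrite deriveE // [in RHS](matrix_sum_delta v) mxE linear_sum.
apply: eq_bigr => j _; rewrite big_ord1 linearZ mxE deriveE //.
by rewrite mulrC.
Qed.

(** This is the inequality dh(t) <= C t integrated over [0, 1], obtained from
the mean value theorem: h(t) - C t^2 / 2 has a nonpositive derivative. *)
Lemma increment_le_of_derive_le (R : realType) (h dh : R -> R) (C : R) :
  (forall t : R, 0 <= t <= 1 -> is_derive t 1 h (dh t)) ->
  (forall t : R, 0 <= t <= 1 -> dh t <= C * t) ->
  h 1 - h 0 <= C / 2.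
Proof.
move=> hd dhle.
pose k : R -> R := h - (C / 2) \*: (@idfun R ^+ 2).
have kE t : k t = h t - C / 2 * t ^+ 2 by [].
have kd (t : R) : 0 <= t <= 1 -> is_derive t 1 k (dh t - C * t).
  move=> t01; have ht := hd _ t01; rewrite /k.
  apply: is_derive_eq; rewrite /= expr1 /GRing.scale /=; by field.
have [||c] := @MVT_segment R k (fun t => dh t - C * t) 0 1 ler01.
- by move=> t; rewrite in_itv /= => /andP[t0 t1]; apply: kd; rewrite !ltW.
- apply: derivable_within_continuous => t; rewrite in_itv /= => /kd kt.
  exact: ex_derive.
rewrite in_itv /= => /dhle; rewrite !kE; lra.
Qed.

(** The l1 norm of the remainder r is a linear functional of r once the signs of
the entries of r are fixed. Pairing the vector remainder along the segment with
these signs reduces the claim to one real function, whose derivative is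
at most the l1 norm of (jac g (x + t v) - jac g x) v. *)
Lemma l1norm_first_order_remainder (R : realType) p q
    (g : 'cV[R]_p -> 'cV[R]_q) (x v : 'cV[R]_p) (L : R) :
  (forall t : R, 0 <= t <= 1 -> differentiable g (x + t *: v)) ->
  (forall t : R, 0 <= t <= 1 ->
     l1opnorm (jac g (x + t *: v) - jac g x) <= L * t) ->
  l1norm (g (x + v) - g x - jac g x *m v) <= L * l1norm v / 2.
Proof.
move=> dg Lip; set r := g (x + v) - g x - jac g x *m v.
pose psi t :=
  \sum_i Num.sg (r i 0) * (g (x + t *: v) i 0 - t * (jac g x *m v) i 0).
pose dpsi t :=
  \sum_i Num.sg (r i 0) * ((jac g (x + t *: v) - jac g x) *m v) i 0.
have -> : l1norm r = psi 1 - psi 0.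
  rewrite /psi -sumrB; apply: eq_bigr => i _.
  by rewrite scale1r scale0r addr0 mul1r mul0r subr0 -mulrBr normrEsg
    !mxE; congr (_ * _); lra.
apply: (@increment_le_of_derive_le _ psi dpsi) => t t01.
  pose gi i (s : R) := g (x + s *: v) i 0.
  pose F i := Num.sg (r i 0) \*: (gi i - (jac g x *m v) i 0 \*: @idfun R).
  have -> : psi = \sum_i F i.
    apply/funext => s; rewrite fct_sumE; apply: eq_bigr => i _.
    by congr (_ * (_ - _)); rewrite mulrC.
  apply: is_derive_sum => i.
  have gid : is_derive t 1 (gi i) ((jac g (x + t *: v) *m v) i 0).
    rewrite jac_mulmxE; last exact: dg.
    apply: (@is_derive_along_line _ _ (fun y => g y i 0)).
    exact/differentiable_entry/dg.
  apply: is_derive_eq.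
  congr (_ * _); rewrite mulmxBl [RHS]mxE [X in _ = _ + X]mxE /=.
  congr (_ + - _); exact: mulr1.
have -> : L * l1norm v * t = L * t * l1norm v by lra.
apply: (le_trans _ (ler_wpM2r (l1norm_ge0 v) (Lip t t01))).
apply: (le_trans _ (l1norm_mulmx_le _ _)); apply: ler_sum => i _.
apply: le_trans (ler_norm _) _; rewrite normrM.
by rewrite ler_piMl // normr_sg lern1 leq_b1.
Qed.

Lemma l1norm_decision (R : realType) m N (W : 'cV[R]_(N * m + 1)) :
  l1norm W = l1norm (inputs W) + `|horizon W|.
Proof.
rewrite /l1norm big_split_ord /= big_ord1 /horizon mxE; congr (_ + _).
by apply: eq_bigr => i _; rewrite mxE.
Qed.

(** The linear constraint of the Newton problem cancels the zeroth and first
order terms of G at U, so that only the quadratic remainder is left. *)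
Lemma l1norm_newton_step (R : realType) n m N
    (G : 'cV[R]_(N * m + 1) -> 'cV[R]_n) (Dom : set 'cV[R]_(N * m + 1))
    (alpha1 alpha2 Sbar s lambda : R) (U W : 'cV[R]_(N * m + 1)) :
  0 <= lambda ->
  (forall V, Dom V -> differentiable G V) ->
  (forall V' V'', Dom V' -> Dom V'' -> `|horizon V' - horizon V''| <= Sbar ->
     l1opnorm (jac G V' - jac G V'') <= lambda * l1norm (V' - V'')) ->
  (forall t : R, 0 <= t <= 1 -> Dom (U - t *: W)) ->
  feasible G alpha1 alpha2 Sbar s U W ->
  l1norm (G (U - W)) <=
    lambda * (alpha1 + alpha2) ^+ 2 / 2 * Num.max (l1norm (G U)) s ^+ 2.
Proof.
move=> l0 dG Lip seg [JW wle]; rewrite le_min => /andP[SleS Sle].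
set M := Num.max _ _ in wle Sle *.
have M0 : 0 <= M by rewrite le_max l1norm_ge0.
have Wle : l1norm W <= (alpha1 + alpha2) * M.
  by rewrite l1norm_decision mulrDl lerD.
have -> : G (U - W) = G (U + - W) - G U - jac G U *m - W.
  by rewrite mulmxN JW opprK subrK.
have segN (t : R) : 0 <= t <= 1 -> Dom (U + t *: - W).
  by rewrite scalerN; exact: seg.
have DU : Dom U by rewrite -[U]addr0 -(scale0r (- W)); apply: segN; lra.
have lin (t : R) : 0 <= t <= 1 ->
    l1opnorm (jac G (U + t *: - W) - jac G U) <= lambda * l1norm W * t.
  move=> t01; have /andP[t0 t1] := t01.
  apply: le_trans (Lip _ _ (segN _ t01) DU _) _.
    rewrite /horizon !mxE addrAC subrr add0r mulrN normrN normrM ger0_norm //.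
    by apply: le_trans SleS; rewrite /horizon mxE ler_piMl.
  by rewrite addrAC subrr add0r l1normZ l1normN ger0_norm // -mulrA
    [t * _]mulrC.
have := l1norm_first_order_remainder (fun t t01 => dG _ (segN t t01)) lin.
rewrite l1normN => /le_trans; apply.
have W2 : l1norm W * l1norm W <=
    (alpha1 + alpha2) * M * ((alpha1 + alpha2) * M).
  by rewrite ler_pM // l1norm_ge0.
by have := ler_wpM2l l0 W2; lra.
Qed.

(** Let M_k be the maximum of g_k and s, and q = c M_0 < 1. As long as
M_k <= M_0, the next term is at most c M_0 M_k = q M_k; since q s < s, induction
gives M_k <= max (q^k M_0) s, and q^k M_0 tends to 0. *)
Lemma quadratic_recurrence_eventually_le (R : realType) (g : nat -> R)
    (c s : R) :
  0 <= c -> 0 < s -> c * g 0%N < 1 -> c * s < 1 ->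
  (forall k, g k.+1 <= c * Num.max (g k) s ^+ 2) ->
  exists K : nat, forall k, (K <= k)%N -> g k <= s.
Proof.
move=> c0 s0 cg0 cs gS.
set M := fun k => Num.max (g k) s; set q := c * M 0%N.
have M0 k : 0 < M k by rewrite lt_max s0 orbT.
have q0 : 0 <= q by rewrite mulr_ge0 // ltW.
have q1 : q < 1 by rewrite /q /M maxr_pMr // gt_max cg0.
have Mle k : M k <= Num.max (q ^+ k * M 0%N) s.
  elim: k => [|k IH]; first by rewrite expr0 mul1r le_max lexx.
  have MkM0 : M k <= M 0%N.
    apply: le_trans IH _; rewrite ge_max; apply/andP; split.
      by apply: ler_piMl; [exact: ltW|exact: exprn_ile1 (ltW q1)].
    by rewrite le_max lexx orbT.
  have gq : g k.+1 <= q * M k.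
    apply: le_trans (gS k) _; rewrite -/(M k) expr2 mulrA ler_pM2r //.
    by rewrite ler_wpM2l.
  rewrite {1}/M ge_max [X in _ && X]le_max lexx orbT andbT.
  apply: le_trans gq _; apply: le_trans (ler_wpM2l q0 IH) _.
  rewrite maxr_pMr // exprS mulrA ge_max !le_max lexx /=.
  by rewrite (ler_piMl (ltW s0) (ltW q1)) orbT.
have /cvgrPdist_lt /(_ (s / M 0%N)) : (GRing.exp q : R^nat) @ \oo --> 0.
  by apply: cvg_expr; rewrite ger0_norm.
case; first by rewrite divr_gt0.
move=> K _ KP; exists K => k /KP /=.
rewrite sub0r normrN ger0_norm ?exprn_ge0 // ltr_pdivlMr // => qk.
apply: (@le_trans _ _ (M k)); first by rewrite le_max lexx.
by apply: le_trans (Mle k) _; rewrite ge_max lexx (ltW qk).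
Qed.

Theorem theorem2 (R : realType) (n m N : nat)
    (f : 'cV[R]_n -> 'cV[R]_m -> R -> 'cV[R]_n) (x0 xf : 'cV[R]_n)
    (Dom : set 'cV[R]_(N * m + 1))
    (alpha1 alpha2 Sbar sigma lambda : R) (U : nat -> 'cV[R]_(N * m + 1)) :
  let G := @terminal_error R n m N f x0 xf in
  (0 < n)%N -> (0 < m)%N -> (0 < N)%N ->
  0 < alpha1 -> 0 < alpha2 -> 0 < Sbar -> 0 < sigma -> 0 < lambda ->
  C1_near G Dom ->
  (forall V, Dom V -> row_free (jac_u G V)) ->
  (forall V, Dom V -> l1opnorm (pinv_mp (jac_u G V)) <= alpha1) ->
  (forall V' V'', Dom V' -> Dom V'' -> `|horizon V' - horizon V''| <= Sbar ->
     l1opnorm (jac G V' - jac G V'') <= lambda * l1norm (V' - V'')) ->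
  lambda * (alpha1 + alpha2) ^+ 2 * l1norm (G (U 0%N)) / 2 < 1 ->
  sigma < 2 / (lambda * (alpha1 + alpha2) ^+ 2) ->
  newton_iterates G alpha1 alpha2 Sbar (fun=> sigma) U ->
  (forall k (t : R), 0 <= t <= 1 -> Dom (U k + t *: (U k.+1 - U k))) ->
  exists kbar : nat, (0 < kbar)%N /\
    forall k, (kbar <= k)%N -> l1norm (G (U k)) <= sigma.
Proof.
move=> G _ _ _ a10 a20 _ s0 l0 [A [_ DO dG _]] _ _ Lip g0 slt iter seg.
set c := lambda * (alpha1 + alpha2) ^+ 2 / 2.
have c0 : 0 < c by rewrite !mulr_gt0 ?exprn_gt0 ?addr_gt0.
have [||k|K KP] := @quadratic_recurrence_eventually_le R
  (fun k => l1norm (G (U k))) c sigma (ltW c0) s0.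
- by rewrite /c mulrAC.
- by rewrite -ltr_pdivlMl // mulr1 /c invf_div.
- have [W [[feas _] UW]] := iter k; rewrite UW.
  apply: (l1norm_newton_step (ltW l0) _ Lip _ feas).
    by move=> V /DO/dG.
  move=> t t01.
  by have := seg k t t01; rewrite UW addrAC subrr add0r scalerN.
by exists K.+1; split=> // k /ltnW /KP.
Qed.
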